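(* For every constant $\beta<1$ ($\beta\ge 0$) there exist constants $\nu_\beta>0$ and $C_\beta\geq 0$, depending only on $\beta$, such that the following holds. Let $(h_i)_{i\in\mathbb Z}$, $(u_i)_{i\in\mathbb Z}$, $(z_i)_{i\in\mathbb Z}$ be discrete data with $h_i\ge0$, and $U_i=(h_i,h_iu_i)^T$. Let $v_m\geq 0$ be such that, for all $i$, $M(U_i,\xi)>0\Rightarrow|\xi|\leq v_m$ (equivalently $|u_i|+\sqrt{2gh_i}\leq v_m$), and assume the CFL condition $$\sigma_i v_m\leq\beta<1\quad\text{for all } i .$$ Let $f_i^{n+1-}$ be defined by the kinetic scheme $$f_i^{n+1-}=M_i-\sigma_i\Bigl(\xi\mathbf 1_{\xi<0}M_{i+1/2+}+\xi\mathbf 1_{\xi>0}M_{i+1/2-}+\delta M_{i+1/2-}-\xi\mathbf 1_{\xi>0}M_{i-1/2-}-\xi\mathbf 1_{\xi<0}M_{i-1/2+}-\delta M_{i-1/2+}\Bigr)$$ with $$\delta M_{i+1/2-}=(\xi-u_i)(M_i-M_{i+1/2-}),\qquad \delta M_{i-1/2+}=(\xi-u_i)(M_i-M_{i-1/2+}).$$ Then, for all $i\in\mathbb Z$ and all $\xi\in\mathbb R$: (i) $f_i^{n+1-}\geq 0$. (ii) The following kinetic entropy inequality holds: $$\begin{aligned} H(f_i^{n+1-},z_i)\leq{}& H(M_i,z_i)-\sigma_i\bigl(\widetilde H_{i+1/2-}-\widetilde H_{i-1/2+}\bigr)\\ &-\nu_\beta\,\sigma_i|\xi|\frac{g^2\pi^2}{6}\Bigl(\mathbf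 1_{\xi<0}(M_{i+1/2+}+M_{i+1/2-})(M_{i+1/2+}-M_{i+1/2-})^2\\ &\qquad\qquad+\mathbf 1_{\xi>0}(M_{i-1/2-}+M_{i-1/2+})(M_{i-1/2+}-M_{i-1/2-})^2\Bigr)\\ &+C_\beta(\sigma_iv_m)^2\frac{g^2\pi^2}{6}M_i\Bigl((M_i-M_{i+1/2-})^2+(M_i-M_{i-1/2+})^2\Bigr). \end{aligned}$$
   Context: $g>0$ is a constant. A grid with cells of lengths $\Delta x_i>0$ ($i\in\mathbb Z$) and a timestep $\Delta t^n>0$ are given, and $\sigma_i=\Delta t^n/\Delta x_i$. The discrete state at time $t^n$ is $U_i=(h_i,h_iu_i)^T$ with $h_i\ge 0$, $u_i\in\mathbb R$, and $z_i\in\mathbb R$ is the discrete topography. Maxwellian: for $U=(h,hu)^T$, $h\ge0$, and $\xi\in\mathbb R$, $M(U,\xi)=\frac1{g\pi}\bigl(2gh-(\xi-u)^2\bigr)_+^{1/2}$, where $x_+=\max(0,x)$. Hydrostatic reconstruction: $z_{i+1/2}=\max(z_i,z_{i+1})$, $h_{i+1/2-}=(h_i+z_i-z_{i+1/2})_+$, $h_{i+1/2+}=(h_{i+1}+z_{i+1}-z_{i+1/2})_+$, $U_{i+1/2-}=(h_{i+1/2-},h_{i+1/2-}u_i)^T$ (velocity $u_i$), $U_{i+1/2+}=(h_{i+1/2+},h_{i+1/2+}u_{i+1})^T$ (velocity $u_{i+1}$). Notation: $M_i=M(U_i,\xi)$, $M_{i+1/2\pm}=M(U_{i+1/2\pm},\xi)$;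 the dependence of all kinetic quantities on $\xi$ is omitted. $\mathbf 1$ denotes an indicator function. Kinetic entropy: for $f\ge 0$, $H(f,z)=H(f,\xi,z)=\frac{\xi^2}{2}f+\frac{g^2\pi^2}{6}f^3+gzf$. Entropy: $\eta(U)=h\frac{u^2}2+g\frac{h^2}2$, and its derivative with respect to $U=(h,hu)^T$ is $\eta'(U)=(gh-u^2/2,\;u)$, so that $\eta'(U)\begin{pmatrix}1\\ \xi\end{pmatrix}=gh-u^2/2+\xi u$. Kinetic entropy fluxes: $$\begin{aligned}\widetilde H_{i+1/2-}={}&\xi\mathbf 1_{\xi<0}H(M_{i+1/2+},z_{i+1/2})+\xi\mathbf 1_{\xi>0}H(M_{i+1/2-},z_{i+1/2})+\xi H(M_i,z_i)-\xi H(M_{i+1/2-},z_{i+1/2})\\&+\Bigl(\eta'(U_i)\begin{pmatrix}1\\ \xi\end{pmatrix}+gz_i\Bigr)\bigl(\xi M_{i+1/2-}-\xi M_i+\delta M_{i+1/2-}\bigr),\end{aligned}$$ $$\begin{aligned}\widetilde H_{i-1/2+}={}&\xi\mathbf 1_{\xi<0}H(M_{i-1/2+},z_{i-1/2})+\xi\mathbf 1_{\xi>0}H(M_{i-1/2-},z_{i-1/2})+\xi H(M_i,z_i)-\xi H(M_{i-1/2+},z_{i-1/2})\\&+\Bigl(\eta'(U_i)\begin{pmatrix}1\\ \xi\end{pmatrix}+gz_i\Bigr)\bigl(\xi M_{i-1/2+}-\xi M_i+\delta M_{i-1/2+}\bigr).\end{aligned}$$ *)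

(* Defs.v *)
From Stdlib Require Import Reals ZArith.
Open Scope R_scope.

Definition pos_part (x : R) : R := Rmax 0 x.

Definition indic {A B : Prop} (b : {A} + {B}) : R := if b then 1 else 0.

(* A state U = (h, hu) is given by the pair (h, u): when h = 0 the velocity
   cannot be recovered from U, but it is still part of the discrete data. *)

Definition maxwell (g h u xi : R) : R :=
  / (g * PI) * sqrt (pos_part (2 * g * h - (xi - u) ^ 2)).

Definition kinH (g f xi z : R) : R :=
  xi ^ 2 / 2 * f + g ^ 2 * PI ^ 2 / 6 * f ^ 3 + g * z * f.

(* Gradient of eta(U) = h u^2 / 2 + g h^2 / 2 in the conservative variables
   (h, q) with q = h u. *)
Definition eta' (g h u : R) : R * R := (g * h - u ^ 2 / 2, u).

Definition dot (v w : R * R) : R := fst v * fst w + snd v * snd w.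

(* Interface quantities: the index i stands for the interface i + 1/2 between
   the cells i and i + 1; the suffixes m and p stand for its sides - and +. *)

Definition z_half (z : Z -> R) (i : Z) : R := Rmax (z i) (z (i + 1)%Z).

Definition h_half_m (h z : Z -> R) (i : Z) : R :=
  pos_part (h i + z i - z_half z i).

Definition h_half_p (h z : Z -> R) (i : Z) : R :=
  pos_part (h (i + 1)%Z + z (i + 1)%Z - z_half z i).

Definition M_half_m (g : R) (h u z : Z -> R) (xi : R) (i : Z) : R :=
  maxwell g (h_half_m h z i) (u i) xi.

Definition M_half_p (g : R) (h u z : Z -> R) (xi : R) (i : Z) : R :=
  maxwell g (h_half_p h z i) (u (i + 1)%Z) xi.

(* Cell quantities: here i is the cell, and the suffix right refers to
   (i + 1/2)-, the suffix left to (i - 1/2)+. *)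

Definition deltaM_right (g : R) (h u z : Z -> R) (xi : R) (i : Z) : R :=
  (xi - u i) * (maxwell g (h i) (u i) xi - M_half_m g h u z xi i).

Definition deltaM_left (g : R) (h u z : Z -> R) (xi : R) (i : Z) : R :=
  (xi - u i) * (maxwell g (h i) (u i) xi - M_half_p g h u z xi (i - 1)%Z).

Definition H_tilde_right (g : R) (h u z : Z -> R) (xi : R) (i : Z) : R :=
  let Mi := maxwell g (h i) (u i) xi in
  let Mm := M_half_m g h u z xi i in
  let Mp := M_half_p g h u z xi i in
  let zh := z_half z i in
  xi * indic (Rlt_dec xi 0) * kinH g Mp xi zh
  + xi * indic (Rlt_dec 0 xi) * kinH g Mm xi zh
  + xi * kinH g Mi xi (z i) - xi * kinH g Mm xi zh
  + (dot (eta' g (h i) (u i)) (1, xi) + g * z i)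
    * (xi * Mm - xi * Mi + deltaM_right g h u z xi i).

Definition H_tilde_left (g : R) (h u z : Z -> R) (xi : R) (i : Z) : R :=
  let Mi := maxwell g (h i) (u i) xi in
  let Mm := M_half_m g h u z xi (i - 1)%Z in
  let Mp := M_half_p g h u z xi (i - 1)%Z in
  let zh := z_half z (i - 1)%Z in
  xi * indic (Rlt_dec xi 0) * kinH g Mp xi zh
  + xi * indic (Rlt_dec 0 xi) * kinH g Mm xi zh
  + xi * kinH g Mi xi (z i) - xi * kinH g Mp xi zh
  + (dot (eta' g (h i) (u i)) (1, xi) + g * z i)
    * (xi * Mp - xi * Mi + deltaM_left g h u z xi i).

Definition f_new (g : R) (sigma h u z : Z -> R) (xi : R) (i : Z) : R :=
  maxwell g (h i) (u i) xi
  - sigma i *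
    (xi * indic (Rlt_dec xi 0) * M_half_p g h u z xi i
     + xi * indic (Rlt_dec 0 xi) * M_half_m g h u z xi i
     + deltaM_right g h u z xi i
     - xi * indic (Rlt_dec 0 xi) * M_half_m g h u z xi (i - 1)%Z
     - xi * indic (Rlt_dec xi 0) * M_half_p g h u z xi (i - 1)%Z
     - deltaM_left g h u z xi i).

(* Main.v *)
Require Import Defs.
From Stdlib Require Import Reals ZArith.
From Stdlib Require Import Lra Psatz.
Open Scope R_scope.

(** Fix a cell and a velocity [xi], write [M] for the cell Maxwellian, [s] for
    [sigma |xi|], and look at the side from which particles of velocity [xi]
    enter: the right one for [xi <= 0], the left one for [xi >= 0]. Let [a] be
    the reconstructed Maxwellian just inside that side, [p] the one just
    outside, [b] the reconstructed Maxwellian inside the other side. With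
    [v = u] for [xi <= 0] and [v = -u] for [xi >= 0], the scheme collapses to

      f = M + s (p - a) - sigma v (a - b),

    so that the two signs of [xi] are mirror images of each other.

    Let [k = g^2 pi^2 / 6] and let [E] be the factor of the mass corrections in
    the kinetic entropy fluxes. Hydrostatic reconstruction preserves
    [h + z] as long as no depth is cut off, hence [E] is the derivative of
    [H(., z)] at [M] and of [H(., z')] at [a], where [z'] is the interface
    topography, whenever these densities are positive
    ([kinH_at_maxwell]); if [a = 0] that derivative is at least [E], which is
    all that the convexity inequality for [p >= a] requires
    ([kinH_above_tangent]). All terms linear in [f - M] then cancel against the
    fluxes. Since [H(., z)] is an affine function plus [k f^3], what is left
    for [M > 0] is a polynomial inequality: with [D = p - a] and
    [e = sigma v (a - b)],

      (sD - e)^2 (3M + sD - e) <= s (p + 2a) D^2 - nu s (p + a) D^2 + error.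

    If [e = 0] and [a = M], the left-hand side is [s^2 D^2 (3M + sD)], which
    the strict CFL bound [s <= beta < 1] leaves a fixed proportion
    below [s (p + 2a) D^2]. The deviations [e] and [M - a] are absorbed by
    Young's inequality and by the dichotomy of [absorb_small]; what they leave
    is of order [(sigma vm)^2 M ((M - a)^2 + (M - b)^2)]
    ([upwind_cubic_estimate]). For [M = 0] the cell only receives [f = s p],
    and the inequality follows from [s <= beta] and [z <= z']. *)

(** * The cubic inequality behind the dissipation *)

(** The constant of the quadratic error when each deviation from the leading
    term may use up a dissipation of order [eps = (1 - beta) / 8]: the first
    summand is [6 / (eps / 6)^2], six uses of [absorb_small] with
    [delta = eps / 6]; the other two come from Young's inequality. *)
Definition error_const (eps : R) : R :=
  216 / eps ^ 2 + 4 * (1 + 1 / eps) + (1 + 1 / eps) ^ 2 / (4 * eps).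

Lemma error_const_ge0 (eps : R) : 0 < eps -> 0 <= error_const eps.
Proof.
intros He; unfold error_const.
assert (H1 : 0 < / eps) by now apply Rinv_0_lt_compat.
assert (H2 : 0 < / eps ^ 2) by (apply Rinv_0_lt_compat; nra).
assert (H3 : 0 < / (4 * eps)) by (apply Rinv_0_lt_compat; lra).
unfold Rdiv; rewrite Rmult_1_l.
assert (0 <= (1 + / eps) ^ 2 * / (4 * eps)) by (apply Rmult_le_pos; nra).
lra.
Qed.

(** Either [q] is at most [delta P] and the left-hand side is absorbed, or
    [|D| <= P < q / delta] and then it is cubic in [w]. It is used with [P D^2]
    as dissipation and [Y] as error. *)
Lemma absorb_small (delta q P D w Y : R) :
  0 < delta -> 0 <= q <= w -> 0 <= P -> Rabs D <= P -> w ^ 3 <= Y ->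
  q * D ^ 2 <= delta * (P * D ^ 2) + Y / delta ^ 2.
Proof.
intros Hd [Hq Hw] HP HD HY.
assert (HD2 : D ^ 2 <= P ^ 2).
{ rewrite <- (pow2_abs D). apply pow_incr. split; [apply Rabs_pos | exact HD]. }
assert (HY0 : 0 <= Y) by (pose proof (pow_le w 3 (Rle_trans _ _ _ Hq Hw)); lra).
assert (Hd2 : 0 < delta ^ 2) by nra.
assert (HYd : 0 <= Y / delta ^ 2) by (apply Rle_mult_inv_pos; lra).
pose proof (pow2_ge_0 D) as HD0.
destruct (Rle_lt_dec q (delta * P)) as [Hle | Hlt].
- assert (q * D ^ 2 <= delta * P * D ^ 2) by now apply Rmult_le_compat_r.
  lra.
- assert (H1 : delta ^ 2 * P ^ 2 <= q ^ 2).
  { rewrite <- Rpow_mult_distr. apply pow_incr. nra. }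
  assert (H2 : delta ^ 2 * (q * D ^ 2) <= Y).
  { assert (delta ^ 2 * D ^ 2 <= q ^ 2) by nra.
    assert (q ^ 3 <= w ^ 3) by (apply pow_incr; lra).
    assert (q * (delta ^ 2 * D ^ 2) <= q * q ^ 2) by now apply Rmult_le_compat_l.
    nra. }
  assert (H3 : q * D ^ 2 <= Y / delta ^ 2).
  { apply Rmult_le_reg_l with (1 := Hd2).
    replace (delta ^ 2 * (Y / delta ^ 2)) with Y by (field; lra). exact H2. }
  assert (0 <= delta * (P * D ^ 2)) by (apply Rmult_le_pos; [lra | nra]).
  lra.
Qed.

(** For [a = M] and [e = 0] this only compares the coefficients of [D^2]. In
    general a loss [s^2 (M - a) D^2] appears, without any smallness of [D]; it
    can be paid because either [|D|] is at most of order [s (M - a)], or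
    [p + a] is so large that the dissipation dominates. The same dichotomy
    disposes of [s^2 D^2 |e|], and Young's inequality of the rest. *)
Lemma upwind_cubic_estimate (beta M a b p s e tau : R) :
  0 <= beta < 1 -> 0 <= a <= M -> 0 <= b <= M -> 0 <= p ->
  0 <= s <= tau -> tau <= beta -> Rabs e <= tau * Rabs (a - b) ->
  0 <= M + s * (p - a) - e ->
  (s * (p - a) - e) ^ 2 * (3 * M + s * (p - a) - e) <=
    s * (p + 2 * a) * (p - a) ^ 2
    - (1 - beta) / 2 * s * (p + a) * (p - a) ^ 2
    + error_const ((1 - beta) / 8) * tau ^ 2 * M * ((M - a) ^ 2 + (M - b) ^ 2).
Proof.
intros Hbeta Ha Hb Hp Hs Htau He Hf.
remember (p - a) as D eqn:ED.
remember ((1 - beta) / 8) as eps eqn:Eeps.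
remember (tau ^ 2 * M * ((M - a) ^ 2 + (M - b) ^ 2)) as Y eqn:EY.
remember (s * ((p + a) * D ^ 2)) as X eqn:EX.
assert (Heps : 0 < eps <= 1 / 8) by lra.
assert (HD0 := pow2_ge_0 D).
assert (HPD : 0 <= (p + a) * D ^ 2) by (apply Rmult_le_pos; lra).
assert (HX : 0 <= X) by (subst X; apply Rmult_le_pos; lra).
assert (HD : Rabs D <= p + a) by (apply Rabs_le; lra).
assert (Hab : Rabs (a - b) <= M) by (apply Rabs_le; lra).
assert (He0 := Rabs_pos e).
assert (HeM : Rabs e <= M) by (pose proof (Rabs_pos (a - b)); nra).
assert (HeY : M * Rabs e ^ 2 <= Y).
{ assert (H1 : Rabs e ^ 2 <= (tau * Rabs (a - b)) ^ 2) by (apply pow_incr; lra).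
  rewrite Rpow_mult_distr, (pow2_abs (a - b)) in H1.
  assert (H2 : (a - b) ^ 2 <= (M - a) ^ 2 + (M - b) ^ 2).
  { assert (0 <= (M - a) * (M - b)) by (apply Rmult_le_pos; lra). nra. }
  assert (H3 : tau ^ 2 * (a - b) ^ 2 <= tau ^ 2 * ((M - a) ^ 2 + (M - b) ^ 2))
    by (apply Rmult_le_compat_l; [apply pow2_ge_0 | exact H2]).
  subst Y.
  replace (tau ^ 2 * M * ((M - a) ^ 2 + (M - b) ^ 2))
    with (M * (tau ^ 2 * ((M - a) ^ 2 + (M - b) ^ 2))) by ring.
  apply Rmult_le_compat_l; lra. }
assert (HAY : (s * (M - a)) ^ 3 <= Y).
{ assert (H1 : s ^ 3 <= tau ^ 2).
  { assert (s ^ 2 <= tau ^ 2) by (apply pow_incr; lra).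
    assert (s * s ^ 2 <= 1 * s ^ 2)
      by (apply Rmult_le_compat_r; [apply pow2_ge_0 | lra]). simpl in *; lra. }
  assert (H2 : (M - a) ^ 3 <= M * ((M - a) ^ 2 + (M - b) ^ 2)).
  { assert (H3 := pow2_ge_0 (M - a)). assert (H4 := pow2_ge_0 (M - b)).
    assert ((M - a) * (M - a) ^ 2 <= M * (M - a) ^ 2)
      by (apply Rmult_le_compat_r; lra).
    assert (0 <= M * (M - b) ^ 2) by (apply Rmult_le_pos; lra).
    replace ((M - a) ^ 3) with ((M - a) * (M - a) ^ 2) by ring. lra. }
  rewrite Rpow_mult_distr; subst Y. rewrite Rmult_assoc.
  apply Rmult_le_compat; auto; apply pow_le; lra. }
assert (Hdel : 0 < eps / 6) by lra.
assert (H6 : forall y, y / (eps / 6) ^ 2 = 36 / eps ^ 2 * y)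
  by (intro y; field; lra).
(* The cost of [a] differing from [M]: [|D| <= p + a] makes
   [absorb_small] applicable to [s (M - a)]. *)
assert (HA : s ^ 2 * (M - a) * D ^ 2 <= eps / 6 * X + 36 / eps ^ 2 * Y).
{ pose proof (absorb_small (eps / 6) (s * (M - a)) (p + a) D (s * (M - a)) Y
    Hdel) as H. rewrite H6 in H.
  assert (Hs1 : 0 <= s <= 1) by lra.
  assert (HY0 : 0 <= 36 / eps ^ 2 * Y).
  { rewrite <- H6. apply Rle_mult_inv_pos; [|nra].
    assert (0 <= (s * (M - a)) ^ 3) by (apply pow_le; nra). lra. }
  assert (H0 : 0 <= s * (M - a)) by nra.
  specialize (H (conj H0 (Rle_refl _)) ltac:(lra) HD HAY).
  apply Rmult_le_compat_l with (r := s) in H; [|lra].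
  assert (s * (36 / eps ^ 2 * Y) <= 1 * (36 / eps ^ 2 * Y))
    by (apply Rmult_le_compat_r; lra).
  subst X. lra. }
(* The cost of [e] in the cubic factor, using [|e| <= M] to bound [|e|^3]. *)
assert (HE : s ^ 2 * D ^ 2 * Rabs e <= eps / 6 * X + 36 / eps ^ 2 * Y).
{ assert (HYe : Rabs e ^ 3 <= Y).
  { assert (Rabs e * Rabs e ^ 2 <= M * Rabs e ^ 2)
      by (apply Rmult_le_compat_r; [apply pow2_ge_0 | lra]). simpl in *; lra. }
  assert (Hse : 0 <= s * Rabs e <= Rabs e) by nra.
  pose proof (absorb_small (eps / 6) (s * Rabs e) (p + a) D (Rabs e) Y
    Hdel Hse ltac:(lra) HD HYe) as H. rewrite H6 in H.
  assert (HY0 : 0 <= 36 / eps ^ 2 * Y).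
  { rewrite <- H6. apply Rle_mult_inv_pos; [|nra].
    assert (0 <= Rabs e ^ 3) by (apply pow_le; nra). lra. }
  apply Rmult_le_compat_l with (r := s) in H; [|lra].
  assert (s * (36 / eps ^ 2 * Y) <= 1 * (36 / eps ^ 2 * Y))
    by (apply Rmult_le_compat_r; lra).
  subst X. lra. }
assert (HM : M * (s ^ 2 * D ^ 2) <= X + s ^ 2 * (M - a) * D ^ 2).
{ assert (s ^ 2 * (a * D ^ 2) <= X).
  { subst X. assert (0 <= a * D ^ 2) by (apply Rmult_le_pos; lra).
    assert (0 <= p * D ^ 2) by (apply Rmult_le_pos; lra).
    assert (Hs1 : s ^ 2 <= s) by nra.
    assert (s ^ 2 * (a * D ^ 2) <= s * (a * D ^ 2)) by now apply Rmult_le_compat_r.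
    nra. }
  lra. }
remember (1 + 1 / eps) as L eqn:EL.
assert (HL : 1 <= L).
{ subst L. assert (0 < 1 / eps) by (apply Rdiv_lt_0_compat; lra). lra. }
(* Young's inequality on the square, with a weight close to 1 on the leading
   part; [L] is its conjugate weight. *)
assert (Y1 : (s * D - e) ^ 2 <= (1 + eps) * (s ^ 2 * D ^ 2) + L * Rabs e ^ 2).
{ rewrite pow2_abs.
  assert (Hid : (1 + eps) * (s ^ 2 * D ^ 2) + L * e ^ 2 - (s * D - e) ^ 2
     = (eps * (s * D) + e) ^ 2 / eps) by (subst L; field; lra).
  assert (0 <= (eps * (s * D) + e) ^ 2 / eps)
    by (apply Rle_mult_inv_pos; [apply pow2_ge_0 | lra]). lra. }
(* One factor [|e|] is traded for [M] so that the two sides of Young's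
   inequality are the error and the leading quantity [M s^2 D^2]. *)
assert (Y2 : L * (s * Rabs D * Rabs e ^ 2)
   <= eps * (M * (s ^ 2 * D ^ 2)) + L ^ 2 / (4 * eps) * Y).
{ assert (HsD : 0 <= s * Rabs D) by (apply Rmult_le_pos; [lra | apply Rabs_pos]).
  assert (H1 : s * Rabs D * Rabs e ^ 2 <= M * (s * Rabs D * Rabs e)).
  { assert (Rabs e * (s * Rabs D * Rabs e) <= M * (s * Rabs D * Rabs e))
      by (apply Rmult_le_compat_r; [apply Rmult_le_pos; lra | lra]). simpl in *; lra. }
  assert (H2 : L * (s * Rabs D * Rabs e)
     <= eps * (s ^ 2 * D ^ 2) + L ^ 2 / (4 * eps) * Rabs e ^ 2).
  { rewrite <- (pow2_abs D).
    assert (Hid : eps * (s ^ 2 * Rabs D ^ 2) + L ^ 2 / (4 * eps) * Rabs e ^ 2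
      - L * (s * Rabs D * Rabs e)
      = (2 * eps * (s * Rabs D) - L * Rabs e) ^ 2 / (4 * eps)) by (field; lra).
    assert (0 <= (2 * eps * (s * Rabs D) - L * Rabs e) ^ 2 / (4 * eps))
      by (apply Rle_mult_inv_pos; [apply pow2_ge_0 | lra]). lra. }
  assert (H3 : M * (L * (s * Rabs D * Rabs e))
     <= M * (eps * (s ^ 2 * D ^ 2) + L ^ 2 / (4 * eps) * Rabs e ^ 2))
    by (apply Rmult_le_compat_l; lra).
  assert (H4 : L * (s * Rabs D * Rabs e ^ 2) <= L * (M * (s * Rabs D * Rabs e)))
    by (apply Rmult_le_compat_l; lra).
  assert (H5 : L ^ 2 / (4 * eps) * (M * Rabs e ^ 2) <= L ^ 2 / (4 * eps) * Y).
  { apply Rmult_le_compat_l; [apply Rle_mult_inv_pos; [apply pow2_ge_0 | lra] | exact HeY]. }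
  lra. }
(* The strict CFL bound at work: the coefficients of [a] and [p] are
   [(1 - s) (2 - s)] and [1 - s^2], both at least [1 - beta], up to [eps]. *)
assert (HL0 : (1 + eps) * (s ^ 2 * D ^ 2 * (3 * a + s * D))
   <= s * (p + 2 * a) * D ^ 2 - (1 - beta - 2 * eps) * X).
{ assert (Hc : 0 <= p + 2 * a - (1 + eps) * s * (3 * a + s * D)
                 - (1 - beta - 2 * eps) * (p + a)).
  { replace (p + 2 * a - (1 + eps) * s * (3 * a + s * D)
               - (1 - beta - 2 * eps) * (p + a))
      with (a * ((2 - 3 * s + s ^ 2) - (1 - beta) + eps * (2 - 3 * s + s ^ 2))
            + p * ((1 - s ^ 2) - (1 - beta) + eps * (2 - s ^ 2)))
      by (subst D; ring).
    assert (Hs1 : 0 <= s <= beta) by lra.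
    assert (H1 : 1 - beta <= 2 - 3 * s + s ^ 2) by nra.
    assert (H2 : 1 - beta <= 1 - s ^ 2) by nra.
    apply Rplus_le_le_0_compat; apply Rmult_le_pos; try lra.
    - assert (0 <= eps * (2 - 3 * s + s ^ 2)) by (apply Rmult_le_pos; lra). lra.
    - assert (0 <= eps * (2 - s ^ 2)) by (apply Rmult_le_pos; lra). lra. }
  assert (H : 0 <= s * D ^ 2 * (p + 2 * a - (1 + eps) * s * (3 * a + s * D)
                 - (1 - beta - 2 * eps) * (p + a)))
    by (apply Rmult_le_pos; [apply Rmult_le_pos; lra | exact Hc]).
  subst X. lra. }
(* Balance in units of [eps X]: the leading part gains 6; the terms in
   [M - a] and [e] spend at most 1 together, and [T7] spends 1. The remaining
   4 are the announced dissipation since [(1 - beta) / 2 = 4 eps]. *)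
assert (Hneg : - e <= Rabs e) by (rewrite <- Rabs_Ropp; apply Rle_abs).
assert (Habs : s * D <= s * Rabs D)
  by (apply Rmult_le_compat_l; [lra | apply Rle_abs]).
assert (T1 : (s * D - e) ^ 2 * (3 * M + s * D - e)
   <= ((1 + eps) * (s ^ 2 * D ^ 2) + L * Rabs e ^ 2) * (3 * M + s * D - e))
  by (apply Rmult_le_compat_r; lra).
assert (T2 : s ^ 2 * D ^ 2 * (- e) <= s ^ 2 * D ^ 2 * Rabs e)
  by (apply Rmult_le_compat_l; [apply Rmult_le_pos; [apply pow2_ge_0 | lra] | lra]).
assert (T3 : L * Rabs e ^ 2 * (3 * M + s * D - e)
   <= L * Rabs e ^ 2 * (4 * M + s * Rabs D)).
{ apply Rmult_le_compat_l; [|lra].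
  apply Rmult_le_pos; [lra | apply pow2_ge_0]. }
assert (T4 : L * (M * Rabs e ^ 2) <= L * Y) by (apply Rmult_le_compat_l; lra).
assert (T5 : (3 + 4 * eps) * (s ^ 2 * (M - a) * D ^ 2)
   <= 4 * (eps / 6 * X + 36 / eps ^ 2 * Y)).
{ assert (0 <= s ^ 2 * (M - a) * D ^ 2)
    by (apply Rmult_le_pos; [apply Rmult_le_pos; [apply pow2_ge_0 | lra] | lra]).
  nra. }
assert (T6 : (1 + eps) * (s ^ 2 * D ^ 2 * Rabs e)
   <= 2 * (eps / 6 * X + 36 / eps ^ 2 * Y)).
{ assert (0 <= s ^ 2 * D ^ 2 * Rabs e)
    by (apply Rmult_le_pos; [apply Rmult_le_pos; [apply pow2_ge_0 | lra] | lra]).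
  nra. }
assert (T7 := Rmult_le_compat_l eps _ _ ltac:(lra) HM).
assert (T8 := Rmult_le_compat_l (1 + eps) _ _ ltac:(lra) T2).
assert (Hbe : beta = 1 - 8 * eps) by lra.
assert (EC : error_const eps = 6 * (36 / eps ^ 2) + 4 * L + L ^ 2 / (4 * eps))
  by (unfold error_const; rewrite <- EL; field; lra).
replace (error_const eps * tau ^ 2 * M * ((M - a) ^ 2 + (M - b) ^ 2))
  with (error_const eps * Y) by (subst Y; ring).
replace ((1 - beta) / 2 * s * (p + a) * D ^ 2) with (4 * (eps * X))
  by (subst X; rewrite Hbe; field).
rewrite EC.
assert (HL1 : (1 + eps) * (s ^ 2 * D ^ 2 * (3 * a + s * D))
   <= s * (p + 2 * a) * D ^ 2 - 6 * (eps * X)).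
{ replace (6 * (eps * X)) with ((1 - beta - 2 * eps) * X) by (rewrite Hbe; ring).
  exact HL0. }
remember (36 / eps ^ 2 * Y) as W1.
remember (L ^ 2 / (4 * eps) * Y) as W2.
replace ((6 * (36 / eps ^ 2) + 4 * L + L ^ 2 / (4 * eps)) * Y)
  with (6 * W1 + 4 * (L * Y) + W2) by (subst W1 W2; ring).
lra.
Qed.

(** * Maxwellians and the kinetic entropy *)

Lemma pos_part_ge0 (x : R) : 0 <= pos_part x.
Proof. apply Rmax_l. Qed.

Lemma pos_part_id (x : R) : 0 <= x -> pos_part x = x.
Proof. apply Rmax_right. Qed.

Lemma maxwell_ge0 (g h u xi : R) : 0 < g -> 0 <= maxwell g h u xi.
Proof.
intros Hg; unfold maxwell. assert (HPI := PI_RGT_0).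
apply Rmult_le_pos; [|apply sqrt_pos].
left; apply Rinv_0_lt_compat; nra.
Qed.

Lemma maxwell_mono (g h h' u xi : R) :
  0 < g -> h' <= h -> maxwell g h' u xi <= maxwell g h u xi.
Proof.
intros Hg Hh; unfold maxwell. assert (HPI := PI_RGT_0).
apply Rmult_le_compat_l; [left; apply Rinv_0_lt_compat; nra|].
apply sqrt_le_1_alt; unfold pos_part; apply Rle_max_compat_l.
nra.
Qed.

Lemma maxwell_sym (g h u xi xi' : R) :
  Rabs (xi' - u) = Rabs (xi - u) -> maxwell g h u xi' = maxwell g h u xi.
Proof.
intros H; unfold maxwell.
now rewrite <- (pow2_abs (xi' - u)), H, pow2_abs.
Qed.

(** By symmetry about [u], the Maxwellian is also positive at the point at
    distance [|xi - u|] from [u] on the side away from 0, whose modulus is the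
    left-hand side. This gives more than [|xi| <= vm]: it bounds [u] and
    [xi - u] as well. *)
Lemma maxwell_support (g h u vm xi : R) :
  (forall xi', 0 < maxwell g h u xi' -> Rabs xi' <= vm) ->
  0 < maxwell g h u xi -> Rabs u + Rabs (xi - u) <= vm.
Proof.
intros Hvm Hpos.
assert (Hr := Rabs_pos (xi - u)).
destruct (Rle_lt_dec 0 u) as [Hu | Hu].
- assert (H : Rabs (u + Rabs (xi - u)) <= vm).
  { apply Hvm. rewrite (maxwell_sym _ _ _ xi); auto.
    replace (u + Rabs (xi - u) - u) with (Rabs (xi - u)) by ring.
    apply Rabs_Rabsolu. }
  rewrite (Rabs_right u) by lra. rewrite Rabs_right in H; lra.
- assert (H : Rabs (u - Rabs (xi - u)) <= vm).
  { apply Hvm. rewrite (maxwell_sym _ _ _ xi); auto.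
    replace (u - Rabs (xi - u) - u) with (- Rabs (xi - u)) by ring.
    rewrite Rabs_Ropp. apply Rabs_Rabsolu. }
  rewrite (Rabs_left u) by lra. rewrite Rabs_left in H; lra.
Qed.

(** Common slope of the kinetic entropy at the cell Maxwellian and at its
    reconstructions, wherever these densities are positive. *)
Definition kin_slope (g h u z xi : R) : R := dot (eta' g h u) (1, xi) + g * z.

(** The positive part of the reconstructed depth disappears inside that of the
    Maxwellian, and [h + z] is kept by the reconstruction: the cubic part of
    [H(., z')] makes up exactly for the difference between the slope and its
    linear part, unless the Maxwellian vanishes. *)
Lemma maxwell_sqr (g h u z z' xi : R) :
  0 < g ->
  g ^ 2 * PI ^ 2 / 2 * maxwell g (pos_part (h + z - z')) u xi ^ 2
  = pos_part (kin_slope g h u z xi - (xi ^ 2 / 2 + g * z')).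
Proof.
intros Hg. assert (HPI := PI_RGT_0).
unfold maxwell; rewrite Rpow_mult_distr, pow2_sqrt by apply pos_part_ge0.
replace (g ^ 2 * PI ^ 2 / 2 * ((/ (g * PI)) ^ 2
   * pos_part (2 * g * pos_part (h + z - z') - (xi - u) ^ 2)))
  with (pos_part (2 * g * pos_part (h + z - z') - (xi - u) ^ 2) / 2)
  by (field; lra).
unfold kin_slope, dot, eta', pos_part; cbn [fst snd].
assert (Hw := pow2_ge_0 (xi - u)).
destruct (Rle_lt_dec 0 (h + z - z')) as [H | H].
- rewrite (Rmax_right 0 (h + z - z')) by exact H.
  unfold Rmax; repeat match goal with |- context [Rle_dec 0 ?x] => destruct (Rle_dec 0 x) end; lra.
- rewrite (Rmax_left 0 (h + z - z')) by lra.
  assert (g * (h + z - z') <= 0) by nra.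
  rewrite !Rmax_left; lra.
Qed.

Lemma kinH_taylor (g xi z f a : R) :
  kinH g f xi z - kinH g a xi z
  = (xi ^ 2 / 2 + g * z + g ^ 2 * PI ^ 2 / 2 * a ^ 2) * (f - a)
    + g ^ 2 * PI ^ 2 / 6 * ((f + 2 * a) * (f - a) ^ 2).
Proof. unfold kinH; field. Qed.

(** Where [a > 0] the slope is the derivative of [H(., z')] at [a]. Where
    [a = 0] it may be smaller than the derivative, which is harmless because
    [p - a] is then nonnegative. *)
Lemma kinH_above_tangent (g h u z z' xi p : R) :
  0 < g -> 0 <= p ->
  let a := maxwell g (pos_part (h + z - z')) u xi in
  kin_slope g h u z xi * (p - a)
  + g ^ 2 * PI ^ 2 / 6 * ((p + 2 * a) * (p - a) ^ 2)
  <= kinH g p xi z' - kinH g a xi z'.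
Proof.
intros Hg Hp a; rewrite kinH_taylor.
apply Rplus_le_compat_r.
(* Only the occurrence of [a] in the derivative is to be squared. *)
unfold a at 2; rewrite maxwell_sqr by exact Hg; fold a.
unfold pos_part at 1, Rmax; destruct (Rle_dec 0 _) as [H | H]; [right; ring|].
assert (Ha : a = 0).
{ assert (Hsq := maxwell_sqr g h u z z' xi Hg). fold a in Hsq.
  unfold pos_part at 1, Rmax in Hsq; destruct (Rle_dec 0 _); [lra|].
  assert (HPI := PI_RGT_0).
  assert (0 < g ^ 2 * PI ^ 2) by (apply Rmult_lt_0_compat; now apply pow_lt).
  apply Rmult_integral in Hsq; destruct Hsq as [Hsq | Hsq]; [lra|].
  apply Rsqr_0_uniq; rewrite Rsqr_pow2; exact Hsq. }
rewrite Ha; nra.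
Qed.

Lemma kinH_at_maxwell (g h u z xi f : R) :
  0 < g -> 0 <= h ->
  let M := maxwell g h u xi in
  0 < M ->
  kinH g f xi z - kinH g M xi z
  = kin_slope g h u z xi * (f - M)
    + g ^ 2 * PI ^ 2 / 6 * ((f + 2 * M) * (f - M) ^ 2).
Proof.
intros Hg Hh M HM; rewrite kinH_taylor.
assert (Hsq := maxwell_sqr g h u z z xi Hg).
replace (h + z - z) with h in Hsq by ring.
rewrite (pos_part_id h Hh) in Hsq; fold M in Hsq.
rewrite Hsq; unfold pos_part, Rmax in *; destruct (Rle_dec 0 _); [ring|].
assert (HPI := PI_RGT_0).
assert (0 < g ^ 2 * PI ^ 2 / 2 * M ^ 2); [|lra].
assert (0 < g ^ 2 * PI ^ 2) by (apply Rmult_lt_0_compat; now apply pow_lt).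
apply Rmult_lt_0_compat; [lra | now apply pow_lt].
Qed.

(** * The scheme seen from the inflow side *)

(** The outflow is [(v + |xi|) a - v b] per unit of [sigma]. Its coefficients
    are [|xi - u|] and [|u|] up to signs and add up to [|xi|], so that its
    positive part is at most [vm M] whatever the signs. *)
Lemma upwind_nonneg (beta M a b p sigma vm xi v : R) :
  0 <= beta < 1 -> 0 <= a <= M -> 0 <= b <= M -> 0 <= p -> 0 <= sigma ->
  sigma * vm <= beta ->
  (0 < M -> Rabs xi <= vm /\ Rabs v <= vm /\ Rabs (v + Rabs xi) <= vm) ->
  0 <= M + sigma * Rabs xi * (p - a) - sigma * v * (a - b).
Proof.
intros Hbeta Ha Hb Hp Hsig Hcfl Hv.
assert (Hxi := Rabs_pos xi).
assert (Hsp : 0 <= sigma * Rabs xi * p) by (apply Rmult_le_pos; nra).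
destruct (Rle_lt_dec M 0) as [HM | HM].
{ assert (a = 0) by lra. assert (b = 0) by lra. subst a b. lra. }
destruct (Hv HM) as (H1 & H2 & H3).
assert (Hv1 : - v <= vm)
  by (apply Rle_trans with (2 := H2); rewrite <- Rabs_Ropp; apply Rle_abs).
assert (Hv2 : v + Rabs xi <= vm) by (apply Rle_trans with (2 := H3); apply Rle_abs).
assert (Hout : (v + Rabs xi) * a - v * b <= vm * M).
{ assert (Hvm : 0 <= vm) by lra.
  destruct (Rle_lt_dec 0 v); destruct (Rle_lt_dec 0 (v + Rabs xi)); nra. }
assert (sigma * ((v + Rabs xi) * a - v * b) <= sigma * (vm * M))
  by now apply Rmult_le_compat_l.
assert (sigma * vm * M <= 1 * M) by (apply Rmult_le_compat_r; lra).
lra.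
Qed.

(** Both sides of the cell obey this statement, with [v = u] on the right and
    [v = - u] on the left; the bound on [v + |xi|] is then that on
    [|xi - u|]. The hypothesis on [p] serves the dry case [M = 0], in which
    only the neighbouring cell tells that [xi] is at most [vm]. *)
Lemma upwind_entropy (beta g h u z z' sigma vm xi b p v : R) :
  0 <= beta < 1 -> 0 < g -> 0 <= h -> z <= z' -> 0 <= sigma -> 0 <= vm ->
  sigma * vm <= beta ->
  let M := maxwell g h u xi in
  let a := maxwell g (pos_part (h + z - z')) u xi in
  0 <= b <= M -> 0 <= p ->
  (0 < p -> Rabs xi <= vm) ->
  (0 < M -> Rabs xi <= vm /\ Rabs v <= vm /\ Rabs (v + Rabs xi) <= vm) ->
  let f := M + sigma * Rabs xi * (p - a) - sigma * v * (a - b) in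
  0 <= f /\
  kinH g f xi z <= kinH g M xi z
    + sigma * Rabs xi * (kinH g p xi z' - kinH g a xi z')
    - sigma * v * kin_slope g h u z xi * (a - b)
    - (1 - beta) / 2 * sigma * Rabs xi * (g ^ 2 * PI ^ 2 / 6)
      * ((p + a) * (p - a) ^ 2)
    + error_const ((1 - beta) / 8) * (sigma * vm) ^ 2 * (g ^ 2 * PI ^ 2 / 6) * M
      * ((M - a) ^ 2 + (M - b) ^ 2).
Proof.
intros Hbeta Hg Hh Hz Hsig Hvm Hcfl M a Hb Hp Hpxi Hv f.
assert (Hk : 0 <= g ^ 2 * PI ^ 2 / 6)
  by (assert (H1 := pow2_ge_0 g); assert (H2 := pow2_ge_0 PI); nra).
assert (Ha : 0 <= a <= M).
{ split; [now apply maxwell_ge0|]. apply maxwell_mono; [exact Hg|].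
  apply Rmax_lub; lra. }
assert (Hf : 0 <= f) by now apply upwind_nonneg with beta vm.
split; [exact Hf|].
assert (Hxi := Rabs_pos xi).
assert (Hs : 0 <= sigma * Rabs xi) by now apply Rmult_le_pos.
assert (Htan := kinH_above_tangent g h u z z' xi p Hg Hp); fold a in Htan.
apply (Rmult_le_compat_l _ _ _ Hs) in Htan.
destruct (Rle_lt_dec M 0) as [HM | HM].
(* Dry cell: only [s^3 + (1 - beta) / 2 * s <= s] is needed besides
   [z <= z']. *)
- assert (EM : M = 0) by lra. assert (Ea : a = 0) by lra.
  assert (Eb : b = 0) by lra.
  unfold f; rewrite EM, Ea, Eb.
  destruct (Rle_lt_dec p 0) as [Hp0 | Hp0].
  { replace p with 0 by lra. unfold kinH; nra. }
  assert (Hsb : sigma * Rabs xi <= beta)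
    by (specialize (Hpxi Hp0); nra).
  remember (sigma * Rabs xi) as s.
  assert (Hgz : 0 <= s * p * (g * (z' - z))) by (apply Rmult_le_pos; nra).
  assert (Hc : 0 <= g ^ 2 * PI ^ 2 / 6 * (s * p ^ 3 * (1 - s ^ 2 - (1 - beta) / 2))).
  { apply Rmult_le_pos; [exact Hk|]. apply Rmult_le_pos; [|nra].
    apply Rmult_le_pos; [lra|]. apply pow_le; lra. }
  replace ((1 - beta) / 2 * sigma * Rabs xi) with ((1 - beta) / 2 * s)
    by (subst s; ring).
  unfold kinH. nra.
- destruct (Hv HM) as (H1 & H2 & _).
  assert (Hfid := kinH_at_maxwell g h u z xi f Hg Hh HM); fold M in Hfid.
  assert (Hcub := upwind_cubic_estimate beta M a b p (sigma * Rabs xi)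
     (sigma * v * (a - b)) (sigma * vm) Hbeta Ha Hb Hp).
  assert (Hst : sigma * Rabs xi <= sigma * vm) by now apply Rmult_le_compat_l.
  assert (He : Rabs (sigma * v * (a - b)) <= sigma * vm * Rabs (a - b)).
  { rewrite !Rabs_mult, (Rabs_right sigma) by lra.
    apply Rmult_le_compat_r; [apply Rabs_pos|]. now apply Rmult_le_compat_l. }
  specialize (Hcub (conj Hs Hst) Hcfl He Hf).
  apply (Rmult_le_compat_l _ _ _ Hk) in Hcub.
  replace (f - M) with (sigma * Rabs xi * (p - a) - sigma * v * (a - b)) in Hfid
    by (unfold f; ring).
  replace (f + 2 * M) with (3 * M + sigma * Rabs xi * (p - a) - sigma * v * (a - b))
    in Hfid by (unfold f; ring).
  lra.
Qed.

(** * The entropy inequality in a cell *)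

Lemma M_half_m_bounds (g : R) (h u z : Z -> R) (xi : R) (i : Z) :
  0 < g -> 0 <= h i ->
  0 <= M_half_m g h u z xi i <= maxwell g (h i) (u i) xi.
Proof.
intros Hg Hh; split; [now apply maxwell_ge0|].
apply maxwell_mono; [exact Hg|]. apply Rmax_lub; [exact Hh|].
assert (H := Rmax_l (z i) (z (i + 1)%Z)). unfold z_half; lra.
Qed.

Lemma M_half_p_bounds (g : R) (h u z : Z -> R) (xi : R) (i : Z) :
  0 < g -> 0 <= h (i + 1)%Z ->
  0 <= M_half_p g h u z xi i <= maxwell g (h (i + 1)%Z) (u (i + 1)%Z) xi.
Proof.
intros Hg Hh; split; [now apply maxwell_ge0|].
apply maxwell_mono; [exact Hg|]. apply Rmax_lub; [exact Hh|].
assert (H := Rmax_r (z i) (z (i + 1)%Z)). unfold z_half; lra.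
Qed.

Theorem theorem3p6 :
  forall beta : R, 0 <= beta < 1 ->
  exists nu C : R, 0 < nu /\ 0 <= C /\
  forall (g dt : R) (dx h u z : Z -> R) (vm : R),
  let sigma := fun i : Z => dt / dx i in
  0 < g ->
  0 < dt ->
  (forall i : Z, 0 < dx i) ->
  (forall i : Z, 0 <= h i) ->
  0 <= vm ->
  (forall (i : Z) (xi : R), 0 < maxwell g (h i) (u i) xi -> Rabs xi <= vm) ->
  (forall i : Z, sigma i * vm <= beta) ->
  forall (i : Z) (xi : R),
  let Mi := maxwell g (h i) (u i) xi in
  let Mrm := M_half_m g h u z xi i in
  let Mrp := M_half_p g h u z xi i in
  let Mlm := M_half_m g h u z xi (i - 1)%Z in
  let Mlp := M_half_p g h u z xi (i - 1)%Z in
  let f := f_new g sigma h u z xi i in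
  0 <= f /\
  kinH g f xi (z i) <=
    kinH g Mi xi (z i)
    - sigma i * (H_tilde_right g h u z xi i - H_tilde_left g h u z xi i)
    - nu * sigma i * Rabs xi * (g ^ 2 * PI ^ 2 / 6)
      * (indic (Rlt_dec xi 0) * ((Mrp + Mrm) * (Mrp - Mrm) ^ 2)
         + indic (Rlt_dec 0 xi) * ((Mlm + Mlp) * (Mlp - Mlm) ^ 2))
    + C * (sigma i * vm) ^ 2 * (g ^ 2 * PI ^ 2 / 6) * Mi
      * ((Mi - Mrm) ^ 2 + (Mi - Mlp) ^ 2).
Proof.
intros beta Hbeta.
exists ((1 - beta) / 2), (error_const ((1 - beta) / 8)).
split; [lra|]. split; [apply error_const_ge0; lra|].
intros g dt dx h u z vm sigma Hg Hdt Hdx Hh Hvm0 Hvm Hcfl i xi Mi Mrm Mrp Mlm Mlp f.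
assert (Hsig : 0 <= sigma i) by (left; apply Rdiv_lt_0_compat; auto).
assert (Hrm : 0 <= Mrm <= Mi) by (apply M_half_m_bounds; auto).
assert (Hrp := M_half_p_bounds g h u z xi i Hg (Hh _)); fold Mrp in Hrp.
assert (Hlm := M_half_m_bounds g h u z xi (i - 1)%Z Hg (Hh _)); fold Mlm in Hlm.
assert (Ei : (i - 1 + 1 = i)%Z) by ring.
assert (Hlp : 0 <= Mlp <= Mi).
{ unfold Mi; rewrite <- Ei. apply M_half_p_bounds; auto. }
assert (Hrpv : 0 < Mrp -> Rabs xi <= vm)
  by (intro; apply (Hvm (i + 1)%Z); lra).
assert (Hlmv : 0 < Mlm -> Rabs xi <= vm)
  by (intro; apply (Hvm (i - 1)%Z); lra).
assert (Hsup : 0 < Mi -> Rabs (u i) + Rabs (xi - u i) <= vm)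
  by (intro; now apply (maxwell_support g (h i)); [intro xi'; apply Hvm|]).
assert (ErM : Mrm = maxwell g (pos_part (h i + z i - z_half z i)) (u i) xi)
  by reflexivity.
assert (ElM : Mlp = maxwell g (pos_part (h i + z i - z_half z (i - 1)%Z)) (u i) xi)
  by (unfold Mlp, M_half_p, h_half_p; now rewrite Ei).
unfold f, f_new, H_tilde_right, H_tilde_left, deltaM_right, deltaM_left; cbv zeta.
fold Mi Mrm Mrp Mlm Mlp.
change (dot (eta' g (h i) (u i)) (1, xi) + g * z i)
  with (kin_slope g (h i) (u i) (z i) xi).
(* The value [xi = 0], at which both indicators vanish, is treated with the
   negative velocities. *)
destruct (Rle_lt_dec xi 0) as [Hxi | Hxi].
- destruct (upwind_entropy beta g (h i) (u i) (z i) (z_half z i) (sigma i) vm xi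
    Mlp Mrp (u i)) as [Hf HH]; auto; try lra.
  { apply Rmax_l. }
  { intro HM; split; [now apply (Hvm i)|]. specialize (Hsup HM).
    assert (H1 := Rabs_pos (u i)). assert (H2 := Rabs_pos (xi - u i)).
    split; [lra|]. rewrite (Rabs_left1 xi) by exact Hxi.
    replace (u i + - xi) with (- (xi - u i)) by ring. rewrite Rabs_Ropp; lra. }
  fold Mi in Hf, HH; rewrite <- ErM in Hf, HH.
  rewrite (Rabs_left1 xi) in * by exact Hxi.
  assert (En : xi * indic (Rlt_dec xi 0) = xi)
    by (destruct (Rlt_dec xi 0); unfold indic; [ring | lra]).
  assert (E0 : indic (Rlt_dec 0 xi) = 0)
    by (destruct (Rlt_dec 0 xi); unfold indic; [lra | ring]).
  rewrite !En, !E0.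
  match goal with |- 0 <= ?F /\ kinH _ ?F _ _ <= ?RHS =>
    replace F with (Mi + sigma i * - xi * (Mrp - Mrm) - sigma i * u i * (Mrm - Mlp)) by ring
  end.
  split; [exact Hf|].
  eapply Rle_trans; [exact HH|]. right.
  (* At [xi = 0] the indicator is 0 instead of 1, and only its product with
     [xi] can be simplified. *)
  replace ((1 - beta) / 2 * sigma i * - xi * (g ^ 2 * PI ^ 2 / 6) *
    (indic (Rlt_dec xi 0) * ((Mrp + Mrm) * (Mrp - Mrm) ^ 2)
     + 0 * ((Mlm + Mlp) * (Mlp - Mlm) ^ 2)))
  with ((1 - beta) / 2 * sigma i * - (xi * indic (Rlt_dec xi 0)) * (g ^ 2 * PI ^ 2 / 6) *
    ((Mrp + Mrm) * (Mrp - Mrm) ^ 2)) by ring.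
  rewrite En; ring.
- destruct (upwind_entropy beta g (h i) (u i) (z i) (z_half z (i - 1)%Z) (sigma i)
    vm xi Mrm Mlm (- u i)) as [Hf HH]; auto; try lra.
  { rewrite <- Ei at 1; apply Rmax_r. }
  { intro HM; split; [now apply (Hvm i)|]. specialize (Hsup HM).
    assert (H1 := Rabs_pos (u i)). assert (H2 := Rabs_pos (xi - u i)).
    rewrite Rabs_Ropp, (Rabs_right xi) by lra.
    split; [lra|]. replace (- u i + xi) with (xi - u i) by ring. lra. }
  fold Mi in Hf, HH; rewrite <- ElM in Hf, HH.
  rewrite (Rabs_right xi) in * by lra.
  assert (E1 : indic (Rlt_dec 0 xi) = 1)
    by (destruct (Rlt_dec 0 xi); unfold indic; [ring | lra]).
  assert (E0 : indic (Rlt_dec xi 0) = 0)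
    by (destruct (Rlt_dec xi 0); unfold indic; [lra | ring]).
  rewrite !E1, !E0.
  match goal with |- 0 <= ?F /\ kinH _ ?F _ _ <= ?RHS =>
    replace F with (Mi + sigma i * xi * (Mlm - Mlp) - sigma i * - u i * (Mlp - Mrm)) by ring
  end.
  split; [exact Hf|].
  eapply Rle_trans; [exact HH|]. right; ring.
Qed.
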